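(* Let $\theta>0$, $\beta>1$ and $\alpha\in(0,+\infty)\setminus\{1\}$, and let $G_\alpha$ be the cumulative distribution function of the Pseudo-Lindley alpha power transformed distribution with parameters $(\alpha,\beta,\theta)$. For $u\in(0,1)$ let $G_\alpha^{-1}(1-u)$ denote the solution $x\ge 0$ of $G_\alpha(x)=1-u$, and set $$s(u)=-u\,\frac{d}{du}\Big[G_\alpha^{-1}(1-u)\Big],\qquad 0<u<1.$$ Then for every $\lambda>0$, $$\lim_{u\to 0}\frac{G_\alpha^{-1}(1-\lambda u)-G_\alpha^{-1}(1-u)}{s(u)}=-\log\lambda,$$ and consequently $G_\alpha$ belongs to the Gumbel domain of attraction, $G_\alpha\in D(\Lambda)$.
   Context: The Pseudo-Lindley alpha power transformed (PL-APT) distribution with parameters $\alpha\in(0,+\infty)\setminus\{1\}$, $\beta>1$, $\theta>0$ is the distribution on $[0,\infty)$ whose cumulative distribution function is $G_\alpha(x)=0$ for $x<0$ and, for $x\ge 0$, $$G_{\alpha}(x)=\frac{1-\alpha^{\,1-\beta^{-1}(\beta+\theta x)\exp(-\theta x)}}{1-\alpha}.$$ $\Lambda(x)=\exp(-\exp(-x))$, $x\in\mathbb{R}$, is the Gumbel distribution function. A distribution function $G$ belongs to the Gumbel domain of attraction, written $G\in D(\Lambda)$, if there exist sequences $a_n>0$ and $b_n\in\mathbb{R}$ such that $G(a_nx+b_n)^n\to\Lambda(x)$ as $n\to\infty$ for every $x\in\mathbb{R}$; equivalently, the suitably centered and scaled maximum of $n$ i.i.d. random variables with distribution function $G$ converges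 in law to $\Lambda$. *)

(* Defs.v *)
From Stdlib Require Import Reals ClassicalEpsilon.
From Coquelicot Require Import Coquelicot.

Open Scope R_scope.

Definition PL_APT_cdf (alpha beta theta x : R) : R :=
  if Rlt_dec x 0 then 0
  else (1 - Rpower alpha (1 - / beta * (beta + theta * x) * exp (- (theta * x))))
       / (1 - alpha).

Definition is_nonneg_solution (G : R -> R) (p x : R) : Prop :=
  0 <= x /\ G x = p.

(* [Ginv G p] is an arbitrary real when [G x = p] has no solution [x >= 0], and
   some solution when there are several. *)
Definition Ginv (G : R -> R) (p : R) : R :=
  epsilon (inhabits 0) (is_nonneg_solution G p).

Definition s_fun (G : R -> R) (u : R) : R :=
  - u * Derive (fun v => Ginv G (1 - v)) u.

Definition Gumbel_cdf (x : R) : R := exp (- exp (- x)).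

Definition in_Gumbel_domain (G : R -> R) : Prop :=
  exists a b : nat -> R,
    (forall n, 0 < a n) /\
    forall x : R,
      is_lim_seq (fun n => G (a n * x + b n) ^ n) (Gumbel_cdf x).

(* Main.v *)
Require Import Defs.
From Stdlib Require Import Reals.
From Coquelicot Require Import Coquelicot.
From Stdlib Require Import ClassicalEpsilon Ranalysis5 Lra.

Open Scope R_scope.

(** Write [1 - G = exp (- H)], so that [H] is the cumulative hazard function and
    [h = H'] the hazard rate of the distribution. For PL-APT the survival function
    of the pseudo-Lindley law is [w x = (1 + theta x / beta) exp (- (theta x))],
    and with [z = - w ln alpha], which tends to [0],
    [h = theta (beta - 1 + theta x) / (beta + theta x) * z exp z / (exp z - 1)].
    Hence [h] is positive and tends to [theta] ([PL_APT_has_hazard_limit]): the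
    upper tail is asymptotically exponential. The conclusions hold for every
    distribution on the half-line with a positive hazard rate of positive limit.

    In the variable [t = - ln u] the quantile [G^-1 (1 - u)] is the inverse
    function [q] of [H], and [s u = q' t = 1 / h (q t)], which tends to
    [1 / theta]. A function whose derivative has limit [L] at infinity has
    increments over windows of fixed length [c] tending to [L c]
    ([is_lim_increment]). Applied to [q] with [c = - ln lambda], this is the
    quantile limit ([quantile_ratio_lim]). Applied to [H] with [c = x / theta], it
    says that the tail beyond [b + x / theta], relative to the tail beyond [b],
    tends to [exp (- x)]; taking [b] to be the quantile at tail probability
    [1 / n] gives the Gumbel limit of the powers [G ^ n]
    ([in_Gumbel_domain_of_hazard]). *)

(** * Asymptotics of increments *)

(** Each increment over a window of length [c] is [c] times a value of the
    derivative inside the window, by the mean value theorem, and the window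
    escapes to infinity. *)
Lemma is_lim_increment (f f' : R -> R) (a L c : R) :
  (forall x, a <= x -> is_derive f x (f' x)) ->
  is_lim f' p_infty L ->
  is_lim (fun x => f (x + c) - f x) p_infty (L * c).
Proof.
  intros Hd Hl. apply is_lim_spec. intros eps. apply is_lim_spec in Hl.
  assert (Hc : 0 < Rabs c + 1) by (pose proof (Rabs_pos c); lra).
  destruct (Hl (mkposreal _ (Rdiv_lt_0_compat _ _ (cond_pos eps) Hc))) as [M HM].
  simpl in HM.
  exists (Rmax a M + Rabs c). intros x Hx.
  pose proof (Rmax_l a M) as H1. pose proof (Rmax_r a M) as H2.
  assert (Hmin : x - Rabs c <= Rmin x (x + c)).
  { apply Rmin_glb. pose proof (Rabs_pos c); lra.
    pose proof (Rle_abs (- c)); rewrite Rabs_Ropp in *; lra. }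
  destruct (MVT_gen f x (x + c) f') as [xi [Hxi Heq]].
  - intros y Hy. apply Hd. lra.
  - intros y Hy. apply continuity_pt_filterlim.
    apply (ex_derive_continuous f y). exists (f' y). apply Hd. lra.
  - rewrite Heq. replace (f' xi * (x + c - x) - L * c) with ((f' xi - L) * c) by ring.
    rewrite Rabs_mult.
    assert (Hb : Rabs (f' xi - L) < eps / (Rabs c + 1)) by (apply HM; lra).
    apply Rle_lt_trans with (eps / (Rabs c + 1) * Rabs c).
    + apply Rmult_le_compat_r. apply Rabs_pos. lra.
    + apply Rlt_le_trans with (eps / (Rabs c + 1) * (Rabs c + 1)).
      * apply Rmult_lt_compat_l. apply Rdiv_lt_0_compat; [apply cond_pos | lra]. lra.
      * right. field. lra.
Qed.

(** Since [1 - t = / (1 + t / (1 - t))], the inequality [1 + x <= exp x] bounds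
    [(1 - t) ^ n] on both sides:
    [exp (- (n t / (1 - t))) <= (1 - t) ^ n <= exp (- (n t))]. *)
Lemma is_lim_seq_pow_one_minus (t : nat -> R) (c : R) :
  is_lim_seq t 0 ->
  is_lim_seq (fun n => INR n * t n) c ->
  is_lim_seq (fun n => (1 - t n) ^ n) (exp (- c)).
Proof.
  intros Ht Hc.
  assert (Hpow : forall n x, exp x ^ n = exp (INR n * x)).
  { induction n as [|n IH]; intros x.
    - simpl. now rewrite Rmult_0_l, exp_0.
    - rewrite S_INR. simpl. rewrite IH, <- exp_plus. f_equal. ring. }
  apply is_lim_seq_le_le_loc with
    (u := fun n => exp (- (INR n * t n / (1 - t n))))
    (w := fun n => exp (- (INR n * t n))).
  - pose proof (proj2 (is_lim_seq_spec _ _) Ht (mkposreal 1 Rlt_0_1)) as Hev.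
    revert Hev. apply filter_imp. intros n Hn. simpl in Hn.
    assert (Hn' : 0 < 1 - t n).
    { pose proof (Rle_abs (t n - 0)). lra. }
    split.
    + replace (- (INR n * t n / (1 - t n)))
        with (INR n * (- (t n / (1 - t n)))) by (field; lra).
      rewrite <- Hpow. apply pow_incr. split. apply Rlt_le, exp_pos.
      rewrite exp_Ropp, <- (Rinv_inv (1 - t n)).
      apply Rinv_le_contravar. apply Rinv_0_lt_compat; lra.
      rewrite Rinv_inv.
      replace (/ (1 - t n)) with (1 + t n / (1 - t n)) by (field; lra).
      apply exp_ineq1_le.
    + replace (- (INR n * t n)) with (INR n * - t n) by ring.
      rewrite <- Hpow. apply pow_incr. split. lra.
      pose proof (exp_ineq1_le (- t n)). lra.
  - apply (is_lim_seq_continuous exp).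
    + apply derivable_continuous, derivable_exp.
    + replace (- c) with (- (c / (1 - 0))) by field.
      apply (is_lim_seq_opp _ (c / (1 - 0))), is_lim_seq_div'; try lra; try assumption.
      apply is_lim_seq_minus'; [apply is_lim_seq_const | assumption].
  - apply (is_lim_seq_continuous exp).
    + apply derivable_continuous, derivable_exp.
    + now apply (is_lim_seq_opp _ c).
Qed.

Lemma ln_lt_0 u : 0 < u < 1 -> ln u < 0.
Proof. intros Hu. rewrite <- ln_1. apply ln_increasing; lra. Qed.

Lemma is_lim_div' (f g : R -> R) (x : Rbar) (lf lg : R) :
  is_lim f x lf -> is_lim g x lg -> lg <> 0 ->
  is_lim (fun y => f y / g y) x (lf / lg).
Proof.
  intros Hf Hg Hlg. apply (is_lim_div f g x lf lg); trivial.
  - intros E. now injection E.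
  - exact I.
Qed.

(** * Distributions whose hazard rate has a positive limit *)

(** On the half-line [x >= 0], [H] is the cumulative hazard function
    [- ln (1 - G)] and [h] the hazard rate. The derivative of [H] at [0] is
    two-sided: [H] continues it smoothly across [0], where a distribution
    function such as that of PL-APT has a corner. *)
Record has_hazard_limit (G H h : R -> R) (theta : R) : Prop := {
  cdf_hazard : forall x, 0 <= x -> G x = 1 - exp (- H x);
  hazard_0 : H 0 = 0;
  hazard_derive : forall x, 0 <= x -> is_derive H x (h x);
  hazard_pos : forall x, 0 <= x -> 0 < h x;
  hazard_limit_pos : 0 < theta;
  hazard_lim : is_lim h p_infty theta
}.

(** The quantile in the logarithmic scale [t = - ln u] of tail probabilities,
    where it becomes the inverse function of the cumulative hazard. *)
Definition tail_quantile (G : R -> R) (t : R) : R := Ginv G (1 - exp (- t)).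

Section HazardLimit.
Context {G H h : R -> R} {theta : R} (HG : has_hazard_limit G H h theta).

Lemma hazard_continuous x : 0 <= x -> continuity_pt H x.
Proof.
  intros Hx. apply continuity_pt_filterlim, (ex_derive_continuous H x).
  exists (h x). now apply (hazard_derive _ _ _ _ HG).
Qed.

Lemma hazard_MVT x y : 0 <= x < y ->
  exists c, x <= c <= y /\ H y - H x = h c * (y - x).
Proof.
  intros Hxy. destruct (MVT_gen H x y h) as [c [Hc Heq]].
  - intros z Hz. rewrite Rmin_left in Hz by lra.
    apply (hazard_derive _ _ _ _ HG). lra.
  - intros z Hz. rewrite Rmin_left in Hz by lra. apply hazard_continuous. lra.
  - rewrite Rmin_left, Rmax_right in Hc by lra. now exists c.
Qed.

Lemma hazard_increasing x y : 0 <= x < y -> H x < H y.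
Proof.
  intros Hxy. destruct (hazard_MVT x y Hxy) as [c [Hc Heq]].
  assert (0 < h c * (y - x)).
  { apply Rmult_lt_0_compat; [apply (hazard_pos _ _ _ _ HG)|]; lra. }
  lra.
Qed.

(** Eventually [h > theta / 2], so [H] grows at least linearly. *)
Lemma hazard_unbounded y : exists x, 0 < x /\ y < H x.
Proof.
  pose proof (hazard_limit_pos _ _ _ _ HG) as Hth.
  pose proof (proj2 (is_lim_spec _ _ _) (hazard_lim _ _ _ _ HG)) as Hl.
  assert (Hth2 : 0 < theta / 2) by lra.
  destruct (Hl (mkposreal _ Hth2)) as [M HM]. simpl in HM.
  set (m := Rmax M 0 + 1). set (d := (Rabs (y - H m) + 1) / (theta / 2)).
  pose proof (Rmax_l M 0) as H1. pose proof (Rmax_r M 0) as H2.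
  assert (Hd : 0 < d).
  { apply Rdiv_lt_0_compat; [pose proof (Rabs_pos (y - H m)); lra | lra]. }
  exists (m + d). split; [unfold m; lra|].
  destruct (hazard_MVT m (m + d)) as [c [Hc Heq]]; [unfold m in *; lra|].
  assert (Hhc : theta / 2 < h c).
  { assert (Hc' : M < c) by (unfold m in *; lra).
    apply HM, Rabs_def2 in Hc'. lra. }
  assert (theta / 2 * d < h c * d) by now apply Rmult_lt_compat_r.
  assert (theta / 2 * d = Rabs (y - H m) + 1) by (unfold d; field; lra).
  pose proof (Rle_abs (y - H m)).
  replace (m + d - m) with d in Heq by ring. lra.
Qed.

Lemma is_nonneg_solution_hazard t x :
  is_nonneg_solution G (1 - exp (- t)) x <-> 0 <= x /\ H x = t.
Proof.
  split; intros [Hx Heq]; split; try exact Hx.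
  - rewrite (cdf_hazard _ _ _ _ HG) in Heq by exact Hx.
    assert (He : exp (- H x) = exp (- t)) by lra.
    apply exp_inv in He. lra.
  - rewrite (cdf_hazard _ _ _ _ HG) by exact Hx. now rewrite Heq.
Qed.

Lemma hazard_inverse t : 0 <= t -> exists! x, 0 <= x /\ H x = t.
Proof.
  intros Ht. destruct (hazard_unbounded t) as [b [Hb HbH]].
  destruct (f_interv_is_interv H 0 b t Hb) as [x [Hx Heq]].
  - rewrite (hazard_0 _ _ _ _ HG). lra.
  - intros a Ha. apply hazard_continuous. lra.
  - exists x. split; [split; [lra | exact Heq]|].
    intros z [Hz Hzt].
    destruct (Rtotal_order x z) as [Hlt|[Hlt|Hlt]]; [|exact Hlt|].
    + pose proof (hazard_increasing x z). lra.
    + pose proof (hazard_increasing z x). lra.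
Qed.

Lemma exists_unique_quantile u : 0 < u < 1 ->
  exists! x, is_nonneg_solution G (1 - u) x.
Proof.
  intros Hu.
  assert (Hln : 0 <= - ln u) by (pose proof (ln_lt_0 u Hu); lra).
  destruct (hazard_inverse _ Hln) as [x [Hx Hun]].
  rewrite <- (exp_ln u), <- (Ropp_involutive (ln u)) by lra.
  exists x. split; [now apply is_nonneg_solution_hazard|].
  intros z Hz. apply Hun. now apply is_nonneg_solution_hazard.
Qed.

Lemma tail_quantile_spec t : 0 <= t ->
  0 <= tail_quantile G t /\ H (tail_quantile G t) = t.
Proof.
  intros Ht. apply is_nonneg_solution_hazard. unfold tail_quantile, Ginv.
  apply epsilon_spec. destruct (hazard_inverse t Ht) as [x [Hx _]].
  exists x. now apply is_nonneg_solution_hazard.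
Qed.

Lemma tail_quantile_hazard x : 0 <= x -> 0 <= H x /\ tail_quantile G (H x) = x.
Proof.
  intros Hx.
  assert (HHx : 0 <= H x).
  { rewrite <- (hazard_0 _ _ _ _ HG). destruct Hx as [Hx|<-]; [|lra].
    apply Rlt_le, hazard_increasing. lra. }
  split; [exact HHx|].
  destruct (tail_quantile_spec (H x) HHx) as [Hq Heq].
  destruct (hazard_inverse (H x) HHx) as [z [_ Hun]].
  transitivity z; [symmetry|]; apply Hun; auto.
Qed.

Lemma tail_quantile_increasing s t : 0 <= s < t ->
  tail_quantile G s < tail_quantile G t.
Proof.
  intros Hst.
  destruct (tail_quantile_spec s) as [Hs1 Hs2]; [lra|].
  destruct (tail_quantile_spec t) as [Ht1 Ht2]; [lra|].
  apply Rnot_le_lt. intros [Hlt|Heq].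
  - pose proof (hazard_increasing _ _ (conj Ht1 Hlt)). lra.
  - rewrite Heq in Ht2. lra.
Qed.

Lemma tail_quantile_derive t : 0 < t ->
  is_derive (tail_quantile G) t (/ h (tail_quantile G t)).
Proof.
  intros Ht. set (q := tail_quantile G).
  destruct (tail_quantile_spec (t / 2)) as [Hl _]; [lra|].
  pose proof (tail_quantile_increasing (t / 2) t ltac:(lra)) as Hlq.
  pose proof (tail_quantile_increasing t (t + 1) ltac:(lra)) as Hqu.
  fold q in Hl, Hlq, Hqu.
  (* An increasing inverse of a continuous function is continuous; the range
     [0 <= x <= q (t + 1)] of [q] is a neighbourhood of [q t]. *)
  assert (Hcont : continuity_pt q t).
  { apply (continuity_pt_recip_interv H q 0 (q (t + 1))).
    - lra.
    - intros x y Hx Hxy _. now apply hazard_increasing.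
    - intros x Hx _. rewrite (hazard_0 _ _ _ _ HG) in Hx.
      now apply tail_quantile_spec.
    - intros x Hx Hx'. rewrite (hazard_0 _ _ _ _ HG) in Hx.
      destruct (tail_quantile_spec (t + 1)) as [_ Hq1]; [lra|].
      fold q in Hq1. rewrite Hq1 in Hx'.
      split; [now apply tail_quantile_spec|].
      destruct Hx' as [Hx'| ->]; [|lra].
      apply Rlt_le, tail_quantile_increasing. lra.
    - intros a Ha. apply hazard_continuous. lra.
    - rewrite (hazard_0 _ _ _ _ HG).
      destruct (tail_quantile_spec (t + 1)) as [_ Hq1]; [lra|].
      fold q in Hq1. lra. }
  assert (Hder : forall a, q (t / 2) <= a <= q (t + 1) -> derivable_pt H a).
  { intros a Ha. exists (h a). apply is_derive_Reals, (hazard_derive _ _ _ _ HG). lra. }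
  assert (Hin : q (t / 2) <= q t <= q (t + 1)) by lra.
  assert (Hval : derive_pt H (q t) (Hder (q t) Hin) = h (q t)).
  { apply derive_pt_eq_0, is_derive_Reals, (hazard_derive _ _ _ _ HG). lra. }
  assert (Hpos : 0 < h (q t)) by (apply (hazard_pos _ _ _ _ HG); lra).
  apply is_derive_Reals.
  replace (/ h (q t)) with (1 / derive_pt H (q t) (Hder (q t) Hin))
    by (rewrite Hval; field; lra).
  apply derivable_pt_lim_recip_interv; try lra.
  - exact Hcont.
  - intros x Hx. apply tail_quantile_spec. unfold id. lra.
Qed.

Lemma tail_quantile_lim : is_lim (tail_quantile G) p_infty p_infty.
Proof.
  apply is_lim_spec. intros M.
  pose proof (Rmax_l M 0). pose proof (Rmax_r M 0) as H2.
  destruct (tail_quantile_hazard (Rmax M 0) H2) as [Hpos Heq].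
  exists (H (Rmax M 0)). intros t Ht.
  pose proof (tail_quantile_increasing _ _ (conj Hpos Ht)). lra.
Qed.

Lemma tail_quantile_derive_lim :
  is_lim (fun t => / h (tail_quantile G t)) p_infty (/ theta).
Proof.
  pose proof (hazard_limit_pos _ _ _ _ HG).
  apply (is_lim_inv (fun t => h (tail_quantile G t)) p_infty theta).
  - apply (is_lim_comp h (tail_quantile G) p_infty theta p_infty).
    + apply (hazard_lim _ _ _ _ HG).
    + apply tail_quantile_lim.
    + exists 0. discriminate.
  - intros He. injection He. lra.
Qed.

Lemma Ginv_tail_quantile u : 0 < u -> Ginv G (1 - u) = tail_quantile G (- ln u).
Proof.
  intros Hu. unfold tail_quantile. now rewrite Ropp_involutive, exp_ln.
Qed.

Lemma Ginv_derive u : 0 < u < 1 ->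
  is_derive (fun v => Ginv G (1 - v)) u (- / u * / h (tail_quantile G (- ln u))).
Proof.
  intros Hu.
  apply (is_derive_ext_loc (fun v => tail_quantile G (- ln v))).
  - exists (mkposreal u (proj1 Hu)). intros v Hv.
    apply Rabs_def2 in Hv. simpl in Hv. unfold minus, plus, opp in Hv; simpl in Hv.
    symmetry. apply Ginv_tail_quantile. lra.
  - apply (is_derive_comp (tail_quantile G) (fun v => - ln v)).
    + apply tail_quantile_derive. pose proof (ln_lt_0 u Hu). lra.
    + auto_derive; [lra | ring].
Qed.

(** The factor [u] in [s] cancels the derivative of [- ln u], leaving the
    derivative of the inverse of [H]. *)
Lemma s_fun_hazard u : 0 < u < 1 ->
  s_fun G u = / h (tail_quantile G (- ln u)).
Proof.
  intros Hu. unfold s_fun.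
  rewrite (is_derive_unique (fun v : R => Ginv G (1 - v)) _ _ (Ginv_derive u Hu)).
  assert (0 < h (tail_quantile G (- ln u))).
  { apply (hazard_pos _ _ _ _ HG), tail_quantile_spec.
    pose proof (ln_lt_0 u Hu). lra. }
  field. lra.
Qed.

(** In the variable [t = - ln u] the numerator is the increment of the tail
    quantile over a window of length [- ln lambda], hence tends to
    [- ln lambda / theta], while [s u] tends to [1 / theta]. *)
Lemma quantile_ratio_lim lambda : 0 < lambda ->
  filterlim
    (fun u => (Ginv G (1 - lambda * u) - Ginv G (1 - u)) / s_fun G u)
    (at_right 0) (locally (- ln lambda)).
Proof.
  intros Hlam. pose proof (hazard_limit_pos _ _ _ _ HG) as Hth.
  set (q := tail_quantile G).
  apply (filterlim_ext_loc
           (fun u => (q (- ln u + - ln lambda) - q (- ln u)) / / h (q (- ln u)))).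
  - exists (mkposreal 1 Rlt_0_1). intros u Hu Hpos.
    apply Rabs_def2 in Hu. simpl in Hu. unfold minus, plus, opp in Hu; simpl in Hu.
    rewrite s_fun_hazard, !Ginv_tail_quantile by
      (try apply Rmult_lt_0_compat; lra).
    rewrite ln_mult by lra. unfold q. do 3 f_equal. ring.
  - apply (filterlim_comp _ _ _ (fun u => - ln u)
             (fun t => (q (t + - ln lambda) - q t) / / h (q t)) _ (Rbar_locally p_infty)).
    + apply (filterlim_comp _ _ _ ln Ropp _ (Rbar_locally m_infty)).
      * apply is_lim_ln_0.
      * apply (filterlim_Rbar_opp m_infty).
    + assert (Hq : is_lim (fun t => (q (t + - ln lambda) - q t) / / h (q t))
                     p_infty (/ theta * - ln lambda / / theta)).
      { apply is_lim_div'.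
        - apply (is_lim_increment q (fun t => / h (q t)) 1).
          + intros t Ht. apply tail_quantile_derive. lra.
          + apply tail_quantile_derive_lim.
        - apply tail_quantile_derive_lim.
        - apply Rinv_neq_0_compat. lra. }
      replace (/ theta * - ln lambda / / theta) with (- ln lambda) in Hq
        by (field; lra).
      exact Hq.
Qed.

(** The norming constants are [a_n = 1 / theta] and [b_n], the quantile at
    tail probability [1 / n]. As [H b_n = ln n], the rescaled tail
    [n (1 - G (x / theta + b_n))] is [exp (- (H (b_n + x / theta) - H b_n))],
    and the increment of [H] tends to [x]. *)
Lemma in_Gumbel_domain_of_hazard : in_Gumbel_domain G.
Proof.
  pose proof (hazard_limit_pos _ _ _ _ HG) as Hth.
  set (b := fun n => tail_quantile G (ln (INR n))).
  exists (fun _ => / theta), b. split; [intros _; now apply Rinv_0_lt_compat|].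
  intros x. unfold Gumbel_cdf.
  assert (Hln : is_lim_seq (fun n => ln (INR n)) p_infty).
  { apply (is_lim_comp_seq ln INR p_infty p_infty is_lim_ln_p).
    - exists 0%nat. discriminate.
    - apply is_lim_seq_INR. }
  assert (Hb : is_lim_seq b p_infty).
  { apply (is_lim_comp_seq (tail_quantile G) _ p_infty p_infty).
    - apply tail_quantile_lim.
    - exists 0%nat. discriminate.
    - exact Hln. }
  set (d := fun n => H (b n + x / theta) - H (b n)).
  assert (Hd : is_lim_seq d x).
  { replace x with (theta * (x / theta)) at 1 by (field; lra).
    apply (is_lim_comp_seq (fun y => H (y + x / theta) - H y) b p_infty).
    - apply (is_lim_increment H h 0).
      + apply (hazard_derive _ _ _ _ HG).
      + apply (hazard_lim _ _ _ _ HG).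
    - exists 0%nat. discriminate.
    - exact Hb. }
  assert (Hexp : is_lim_seq (fun n => exp (- d n)) (exp (- x))).
  { apply (is_lim_seq_continuous exp).
    - apply derivable_continuous, derivable_exp.
    - now apply (is_lim_seq_opp _ x). }
  apply (is_lim_seq_ext_loc (fun n => (1 - / INR n * exp (- d n)) ^ n)).
  - pose proof (proj2 (is_lim_seq_spec _ _) Hb (- (x / theta))) as Hev.
    assert (Hev1 : eventually (fun n => (1 <= n)%nat)) by now exists 1%nat.
    generalize (filter_and _ _ Hev Hev1). apply filter_imp. intros n [Hn Hn1].
    assert (HnR : 1 <= INR n) by (apply (le_INR 1); exact Hn1).
    rewrite (cdf_hazard _ _ _ _ HG) by (unfold Rdiv in Hn; lra).
    assert (Hln0 : 0 <= ln (INR n)).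
    { rewrite <- ln_1. apply ln_le; lra. }
    assert (HHb : H (b n) = ln (INR n)) by now apply tail_quantile_spec.
    replace (- H (/ theta * x + b n)) with (- ln (INR n) + - d n).
    2: { unfold d. rewrite HHb.
         replace (b n + x / theta) with (/ theta * x + b n) by (field; lra). ring. }
    now rewrite exp_plus, (exp_Ropp (ln _)), exp_ln by lra.
  - apply is_lim_seq_pow_one_minus.
    + replace 0 with (0 * exp (- x)) by ring.
      apply is_lim_seq_mult'; [|exact Hexp].
      apply (is_lim_seq_inv INR p_infty is_lim_seq_INR). discriminate.
    + apply (is_lim_seq_ext_loc (fun n => exp (- d n))); [|exact Hexp].
      exists 1%nat. intros n Hn. apply (le_INR 1) in Hn. simpl in Hn. field. lra.
Qed.

End HazardLimit.

(** * The hazard rate of the PL-APT distribution *)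

(** Survival function of the pseudo-Lindley distribution on [x >= 0]. *)
Definition PL_tail (beta theta x : R) : R :=
  / beta * (beta + theta * x) * exp (- (theta * x)).

(** [PL_apt_exponent] is the [z] for which [alpha ^ (- PL_tail) = exp z]. *)
Definition PL_apt_exponent (alpha beta theta x : R) : R :=
  - (PL_tail beta theta x * ln alpha).

Definition PL_APT_tail (alpha beta theta x : R) : R :=
  alpha / (1 - alpha) * (exp (PL_apt_exponent alpha beta theta x) - 1).

Definition PL_APT_cumulative_hazard (alpha beta theta x : R) : R :=
  - ln (PL_APT_tail alpha beta theta x).

(** The first factor is the hazard rate of the pseudo-Lindley distribution, the
    second the correction due to the alpha power transformation. *)
Definition PL_APT_hazard (alpha beta theta x : R) : R :=
  let z := PL_apt_exponent alpha beta theta x in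
  theta * ((beta - 1 + theta * x) / (beta + theta * x)) * (exp z / ((exp z - 1) / z)).

Lemma expm1_div_pos z : z <> 0 -> 0 < (exp z - 1) / z.
Proof.
  intros Hz. destruct (Rdichotomy _ _ Hz) as [Hlt|Hgt].
  - apply exp_increasing in Hlt as He. rewrite exp_0 in He.
    replace ((exp z - 1) / z) with ((1 - exp z) / - z) by (field; lra).
    apply Rdiv_lt_0_compat; lra.
  - apply exp_increasing in Hgt as He. rewrite exp_0 in He.
    apply Rdiv_lt_0_compat; lra.
Qed.

(** [w = exp y - y exp y / beta] with [y = - theta x] tending to minus infinity. *)
Lemma PL_tail_lim beta theta : beta <> 0 -> 0 < theta ->
  is_lim (PL_tail beta theta) p_infty 0.
Proof.
  intros Hb Hth.
  assert (Hm : is_lim (fun x => - (theta * x)) p_infty m_infty).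
  { apply is_lim_spec. intros M. exists (- M / theta). intros x Hx.
    apply (Rmult_lt_compat_l theta) in Hx; [|exact Hth].
    replace (theta * (- M / theta)) with (- M) in Hx by (field; lra). lra. }
  assert (Hne : Rbar_locally' p_infty (fun x : R => Finite (- (theta * x)) <> m_infty)).
  { exists 0. discriminate. }
  assert (H1 := is_lim_comp _ _ _ _ _ is_lim_exp_m Hm Hne).
  assert (H2 := is_lim_comp _ _ _ _ _ is_lim_mul_exp_m Hm Hne).
  apply (is_lim_ext (fun x => exp (- (theta * x))
                              - / beta * (- (theta * x) * exp (- (theta * x))))).
  - intros x. unfold PL_tail. field. exact Hb.
  - replace 0 with (0 - / beta * 0) by ring.
    apply is_lim_minus'; [exact H1|].
    apply (is_lim_scal_l _ (/ beta) p_infty 0 H2).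
Qed.

Lemma PL_hazard_lim beta theta : 0 < beta -> 0 < theta ->
  is_lim (fun x => theta * ((beta - 1 + theta * x) / (beta + theta * x)))
    p_infty theta.
Proof.
  intros Hb Hth.
  assert (Hp : is_lim (fun x => beta + theta * x) p_infty p_infty).
  { apply is_lim_spec. intros M. exists (Rmax 0 (M / theta)). intros x Hx.
    pose proof (Rmax_r 0 (M / theta)).
    assert (Hx' : M / theta < x) by lra.
    apply (Rmult_lt_compat_l theta) in Hx'; [|exact Hth].
    replace (theta * (M / theta)) with M in Hx' by (field; lra). lra. }
  apply is_lim_inv in Hp; [|discriminate].
  apply (is_lim_ext_loc (fun x => theta * (1 - / (beta + theta * x)))).
  - exists 0. intros x Hx. assert (0 < theta * x) by now apply Rmult_lt_0_compat.
    field. lra.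
  - assert (Hl : is_lim (fun x => theta * (1 - / (beta + theta * x)))
                   p_infty (theta * (1 - 0))).
    { apply (is_lim_scal_l (fun x => 1 - / (beta + theta * x)) theta p_infty (1 - 0)).
      apply is_lim_minus'; [apply is_lim_const | exact Hp]. }
    now replace (theta * (1 - 0)) with theta in Hl by ring.
Qed.

Section PLAPT.
Context {alpha beta theta : R}
  (Ha : 0 < alpha) (Ha1 : alpha <> 1) (Hb : 1 < beta) (Hth : 0 < theta).

Lemma PL_tail_pos x : 0 <= x -> 0 < PL_tail beta theta x.
Proof.
  intros Hx. pose proof (Rmult_le_pos _ _ (Rlt_le _ _ Hth) Hx).
  unfold PL_tail. apply Rmult_lt_0_compat; [|apply exp_pos].
  apply Rmult_lt_0_compat; [apply Rinv_0_lt_compat|]; lra.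
Qed.

Lemma PL_apt_exponent_neq0 x : 0 <= x -> PL_apt_exponent alpha beta theta x <> 0.
Proof.
  intros Hx. pose proof (PL_tail_pos x Hx). unfold PL_apt_exponent.
  apply Ropp_neq_0_compat, Rmult_integral_contrapositive_currified; [lra|].
  now apply ln_neq_0.
Qed.

(** [exp z - 1] has the sign of [z], which is the sign of [1 - alpha]. *)
Lemma PL_APT_tail_pos x : 0 <= x -> 0 < PL_APT_tail alpha beta theta x.
Proof.
  intros Hx. pose proof (PL_tail_pos x Hx) as Hw.
  pose proof (expm1_div_pos _ (PL_apt_exponent_neq0 x Hx)) as He.
  pose proof (PL_apt_exponent_neq0 x Hx) as Hz.
  unfold PL_APT_tail.
  set (z := PL_apt_exponent alpha beta theta x) in *.
  replace (exp z - 1) with ((exp z - 1) / z * z) by (field; exact Hz).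
  replace (alpha / (1 - alpha) * ((exp z - 1) / z * z))
    with (alpha * ((exp z - 1) / z) * (z / (1 - alpha))) by (field; lra).
  apply Rmult_lt_0_compat; [now apply Rmult_lt_0_compat|].
  unfold z, PL_apt_exponent.
  destruct (Rdichotomy _ _ Ha1) as [Hlt|Hgt].
  - assert (ln alpha < 0) by (apply ln_lt_0; lra).
    apply Rdiv_lt_0_compat; [|lra].
    rewrite Ropp_mult_distr_r. apply Rmult_lt_0_compat; lra.
  - assert (0 < ln alpha) by (rewrite <- ln_1; apply ln_increasing; lra).
    replace (- (PL_tail beta theta x * ln alpha) / (1 - alpha))
      with (PL_tail beta theta x * ln alpha / (alpha - 1)) by (field; lra).
    apply Rdiv_lt_0_compat; [|lra]. now apply Rmult_lt_0_compat.
Qed.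

Lemma PL_APT_cdf_tail x : 0 <= x ->
  PL_APT_cdf alpha beta theta x = 1 - PL_APT_tail alpha beta theta x.
Proof.
  intros Hx. unfold PL_APT_cdf. destruct (Rlt_dec x 0) as [Hlt|_]; [lra|].
  unfold PL_APT_tail, PL_apt_exponent. fold (PL_tail beta theta x).
  replace (Rpower alpha (1 - PL_tail beta theta x))
    with (alpha * exp (- (PL_tail beta theta x * ln alpha))).
  - field. lra.
  - unfold Rminus, Rpower. rewrite Rmult_plus_distr_r, exp_plus, Rmult_1_l, exp_ln by lra.
    do 2 f_equal. ring.
Qed.

(** The exponent is a constant multiple of the pseudo-Lindley survival function,
    so its logarithmic derivative is minus the pseudo-Lindley hazard rate. *)
Lemma PL_apt_exponent_derive x : 0 <= x ->
  is_derive (PL_apt_exponent alpha beta theta) x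
    (- (theta * ((beta - 1 + theta * x) / (beta + theta * x)))
     * PL_apt_exponent alpha beta theta x).
Proof.
  intros Hx. pose proof (Rmult_le_pos _ _ (Rlt_le _ _ Hth) Hx).
  unfold PL_apt_exponent, PL_tail. auto_derive; [exact I|]. field. lra.
Qed.

Lemma PL_APT_hazard_derive x : 0 <= x ->
  is_derive (PL_APT_cumulative_hazard alpha beta theta) x
    (PL_APT_hazard alpha beta theta x).
Proof.
  intros Hx. pose proof (Rmult_le_pos _ _ (Rlt_le _ _ Hth) Hx) as Htx.
  pose proof (PL_APT_tail_pos x Hx) as HT.
  pose proof (PL_apt_exponent_derive x Hx) as Hz.
  pose proof (PL_apt_exponent_neq0 x Hx) as Hz0.
  pose proof (expm1_div_pos _ Hz0) as He.
  unfold PL_APT_cumulative_hazard, PL_APT_hazard, PL_APT_tail in *.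
  set (z := PL_apt_exponent alpha beta theta) in *.
  assert (He0 : exp (z x) - 1 <> 0).
  { intros E. rewrite E in He. unfold Rdiv in He. lra. }
  auto_derive.
  - split; [eexists; exact Hz|]. split; [exact HT | exact I].
  - rewrite (is_derive_unique (fun y : R => z y) _ _ Hz).
    field. repeat split; lra.
Qed.

Lemma PL_APT_hazard_pos x : 0 <= x -> 0 < PL_APT_hazard alpha beta theta x.
Proof.
  intros Hx. pose proof (Rmult_le_pos _ _ (Rlt_le _ _ Hth) Hx) as Htx.
  unfold PL_APT_hazard. apply Rmult_lt_0_compat.
  - apply Rmult_lt_0_compat; [exact Hth|]. apply Rdiv_lt_0_compat; lra.
  - apply Rdiv_lt_0_compat; [apply exp_pos|].
    now apply expm1_div_pos, PL_apt_exponent_neq0.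
Qed.

(** The exponent [z] tends to [0], so the correction factor
    [z exp z / (exp z - 1)] tends to [1]. *)
Lemma PL_APT_hazard_lim : is_lim (PL_APT_hazard alpha beta theta) p_infty theta.
Proof.
  set (z := PL_apt_exponent alpha beta theta).
  assert (Hz : is_lim z p_infty 0).
  { assert (Hl := is_lim_scal_l _ (- ln alpha) _ _
                   (PL_tail_lim beta theta ltac:(lra) Hth)).
    simpl in Hl. rewrite Rmult_0_r in Hl.
    apply (is_lim_ext _ z) in Hl; [exact Hl|].
    intros x. unfold z, PL_apt_exponent. ring. }
  assert (Hne : Rbar_locally' p_infty (fun x : R => Finite (z x) <> Finite 0)).
  { exists 0. intros x Hx E. injection E. apply PL_apt_exponent_neq0. lra. }
  assert (H1 := is_lim_comp _ _ _ _ _ is_lim_div_expm1_0 Hz Hne).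
  assert (H2 : is_lim (fun x => exp (z x)) p_infty 1).
  { rewrite <- exp_0. apply (is_lim_comp exp z p_infty (exp 0) 0); try assumption.
    apply (is_lim_continuity exp 0), derivable_continuous, derivable_exp. }
  assert (Hl : is_lim (PL_APT_hazard alpha beta theta) p_infty (theta * (1 / 1))).
  { apply (is_lim_mult _ _ p_infty theta (1 / 1)).
    - apply PL_hazard_lim; lra.
    - apply is_lim_div'; [exact H2 | exact H1 | lra].
    - exact I. }
  now replace (theta * (1 / 1)) with theta in Hl by field.
Qed.

Lemma PL_APT_has_hazard_limit :
  has_hazard_limit (PL_APT_cdf alpha beta theta)
    (PL_APT_cumulative_hazard alpha beta theta)
    (PL_APT_hazard alpha beta theta) theta.
Proof.
  split.
  - intros x Hx. rewrite PL_APT_cdf_tail by exact Hx.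
    unfold PL_APT_cumulative_hazard.
    rewrite Ropp_involutive, exp_ln; [reflexivity | now apply PL_APT_tail_pos].
  - unfold PL_APT_cumulative_hazard, PL_APT_tail, PL_apt_exponent, PL_tail.
    replace (- (/ beta * (beta + theta * 0) * exp (- (theta * 0)) * ln alpha))
      with (- ln alpha).
    + rewrite exp_Ropp, exp_ln by lra.
      replace (alpha / (1 - alpha) * (/ alpha - 1)) with 1 by (field; lra).
      rewrite ln_1. ring.
    + rewrite Rmult_0_r, Ropp_0, exp_0. field. lra.
  - exact PL_APT_hazard_derive.
  - exact PL_APT_hazard_pos.
  - exact Hth.
  - exact PL_APT_hazard_lim.
Qed.

End PLAPT.

(* The first two conjuncts state that the inverse and its derivative are well
   defined, which Ginv and Derive, being total, do not show by themselves. *)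
Theorem mainTheorem3 :
  forall alpha beta theta : R,
    0 < alpha -> alpha <> 1 -> 1 < beta -> 0 < theta ->
    let G := PL_APT_cdf alpha beta theta in
    (forall u : R, 0 < u < 1 -> exists! x : R, is_nonneg_solution G (1 - u) x) /\
    (forall u : R, 0 < u < 1 -> ex_derive (fun v : R => Ginv G (1 - v)) u) /\
    (forall lambda : R, 0 < lambda ->
       filterlim
         (fun u : R => (Ginv G (1 - lambda * u) - Ginv G (1 - u)) / s_fun G u)
         (at_right 0) (locally (- ln lambda))) /\
    in_Gumbel_domain G.
Proof.
  intros alpha beta theta Ha Ha1 Hb Hth G.
  pose proof (PL_APT_has_hazard_limit Ha Ha1 Hb Hth) as HG. fold G in HG.
  split; [exact (exists_unique_quantile HG)|].
  split; [intros u Hu; eexists; exact (Ginv_derive HG u Hu)|].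
  split; [exact (quantile_ratio_lim HG) | exact (in_Gumbel_domain_of_hazard HG)].
Qed.
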